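(* Let $m\in\mathbb{N}$, $m\ge1$, and let $A$ be a densely defined closed linear operator on a Banach space $X$ which generates a $(1/m)$-times resolvent family $S_{1/m}$. Then for each $x\in D(A^m)$, the function $S_{1/m}(\cdot)x$ solves the fractional Cauchy problem $$D_t^{1/m}u(t)=Au(t),\quad t>0;\qquad u(0)=x,$$ and the initial value problem $$v'(t)=A^mv(t)+\sum_{k=1}^{m-1}g_{k/m}(t)A^kx,\quad t>0;\qquad v(0)=x.$$
   Context: $g_\beta(t)=t^{\beta-1}/\Gamma(\beta)$ for $t>0$ ($\beta>0$), and $g_0=\delta$ is the Dirac delta, so $g_0*h=h$; $(h*k)(t)=\int_0^th(t-s)k(s)\,ds$. For $\alpha>0$, an $\alpha$-times resolvent family generated by $A$ is a family $\{S_\alpha(t)\}_{t\ge0}\subset B(X)$, strongly continuous on $[0,\infty)$ with $S_\alpha(0)=I$, such that $S_\alpha(t)A\subset AS_\alpha(t)$ for $t\ge0$ and $S_\alpha(t)x=x+\int_0^tg_\alpha(t-s)S_\alpha(s)Ax\,ds$ for $x\in D(A)$, $t\ge0$. For $\alpha\in(0,1]$, $D_t^\alpha u$ is the Caputo derivative, understood as $\frac{d}{dt}\big(g_{1-\alpha}*(u-u(0))\big)$. A function $u$ solves $D_t^\alpha u=Au$, $t>0$, $u(0)=x$ if $u\in C([0,\infty);D(A))$ ($D(A)$ with the graph norm), $g_{1-\alpha}*(u-x)\in C^1([0,\infty);X)$, and the equation and initial condition hold. A function $v$ solves the second (first-order, inhomogeneous) problem if $v\in C([0,\infty);X)$ is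 differentiable on $(0,\infty)$, $v(t)\in D(A^m)$ for $t>0$, and the equation for $t>0$ and the initial condition hold. *)

(* Defs.v *)
From Stdlib Require Export Reals.
From Coquelicot Require Export Coquelicot.

Open Scope R_scope.

(* Banach spaces are [CompleteNormedModule R_AbsRing].  A complex Banach space
   is one by restriction of scalars; complex-linear operators, bounded or not,
   are in particular real-linear, and none of the notions below changes. *)

(** * The kernels [g_beta] and convolution *)

Definition Gamma (b : R) : R :=
  RInt_gen (fun t => Rpower t (b - 1) * exp (- t))
           (at_right 0) (Rbar_locally p_infty).

(* Meaningful for [0 < b] and [0 < t] only; the case [b = 0] (Dirac delta) is
   not a function and is treated in [conv_g]. *)
Definition g (b t : R) : R := Rpower t (b - 1) / Gamma b.

(* (g_b * f)(t) for b >= 0 and t >= 0, with g_0 the Dirac delta.  For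
   0 < b < 1 the integrand is singular at s = t, so the integral is the
   improper one, lim_{c -> t-} int_0^c.  It converges for every f continuous
   on [0, oo), the only functions to which [conv_g] is applied below. *)
Definition conv_g {X : CompleteNormedModule R_AbsRing}
    (b : R) (f : R -> X) (t : R) : X :=
  if Req_EM_T b 0 then f t
  else if Rle_dec t 0 then zero
  else RInt_gen (fun s => scal (g b (t - s)) (f s)) (at_point 0) (at_left t).

(** * Unbounded operators *)

(* [op_fun] is relevant on [op_dom] only. *)
Record operator (X : Type) := Operator {
  op_dom : X -> Prop;
  op_fun :> X -> X
}.
Arguments Operator {X} _ _.
Arguments op_dom {X} _ _.
Arguments op_fun {X} _ _.

Record linear_operator {X : NormedModule R_AbsRing} (A : operator X) : Prop := {
  lin_dom_zero : op_dom A zero;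
  lin_dom_plus : forall x y, op_dom A x -> op_dom A y -> op_dom A (plus x y);
  lin_dom_scal : forall (k : R) x, op_dom A x -> op_dom A (scal k x);
  lin_plus : forall x y, op_dom A x -> op_dom A y ->
    A (plus x y) = plus (A x) (A y);
  lin_scal : forall (k : R) x, op_dom A x -> A (scal k x) = scal k (A x)
}.

Definition densely_defined {X : NormedModule R_AbsRing} (A : operator X) : Prop :=
  forall (x : X) (eps : posreal), exists y, op_dom A y /\ ball x eps y.

Definition closed_operator {X : NormedModule R_AbsRing} (A : operator X) : Prop :=
  closed (fun p : X * X => op_dom A (fst p) /\ snd p = A (fst p)).

Definition op_comp {X : Type} (A B : operator X) : operator X :=
  Operator (fun x => op_dom B x /\ op_dom A (B x)) (fun x => A (B x)).

Fixpoint op_pow {X : Type} (A : operator X) (n : nat) : operator X :=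
  match n with
  | O => Operator (fun _ => True) (fun x => x)
  | S k => op_comp A (op_pow A k)
  end.

Definition graph_norm {X : NormedModule R_AbsRing} (A : operator X) (x : X) : R :=
  norm x + norm (A x).

(** * Functions on [[0, oo)]
   They are represented by functions on [R] whose values on the negative
   half-line are irrelevant. *)

Definition nonneg_nbhs (t : R) : (R -> Prop) -> Prop :=
  within (fun s => 0 <= s) (locally t).

Definition continuous_nonneg {X : UniformSpace} (f : R -> X) : Prop :=
  forall t, 0 <= t -> filterlim f (nonneg_nbhs t) (locally (f t)).

(* C([0, oo); D(A)), with the graph norm on D(A) *)
Definition continuous_nonneg_dom {X : NormedModule R_AbsRing}
    (A : operator X) (f : R -> X) : Prop :=
  (forall t, 0 <= t -> op_dom A (f t)) /\
  (forall t, 0 <= t ->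
     filterlim (fun s => graph_norm A (minus (f s) (f t)))
               (nonneg_nbhs t) (locally 0)).

(* C^1([0, oo); X); the derivative at 0 is one-sided *)
Definition C1_nonneg {X : NormedModule R_AbsRing} (f : R -> X) : Prop :=
  exists f' : R -> X,
    (forall t, 0 <= t ->
       filterdiff f (nonneg_nbhs t) (fun h : R => scal h (f' t))) /\
    continuous_nonneg f'.

(** * Resolvent families *)

(* A generates the [alpha]-times resolvent family S, for [alpha > 0];
   Coquelicot's [is_linear] means linear and bounded. *)
Record resolvent_family {X : CompleteNormedModule R_AbsRing}
    (alpha : R) (A : operator X) (S : R -> X -> X) : Prop := {
  rf_bounded : forall t, 0 <= t -> is_linear (S t);
  rf_strong_cont : forall x, continuous_nonneg (fun t => S t x);
  rf_zero : forall x, S 0 x = x;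
  rf_commute : forall t x, 0 <= t -> op_dom A x ->
    op_dom A (S t x) /\ A (S t x) = S t (A x);
  rf_equation : forall t x, 0 <= t -> op_dom A x ->
    S t x = plus x (conv_g alpha (fun s => S s (A x)) t)
}.

(** * The two Cauchy problems *)

(* The Caputo derivative of order [alpha], 0 < alpha <= 1, of u at t is l. *)
Definition is_caputo_derive {X : CompleteNormedModule R_AbsRing}
    (alpha : R) (u : R -> X) (t : R) (l : X) : Prop :=
  is_derive (conv_g (1 - alpha) (fun s => minus (u s) (u 0))) t l.

Record solves_fractional {X : CompleteNormedModule R_AbsRing}
    (alpha : R) (A : operator X) (x : X) (u : R -> X) : Prop := {
  sf_cont : continuous_nonneg_dom A u;
  sf_C1 : C1_nonneg (conv_g (1 - alpha) (fun s => minus (u s) x));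
  sf_equation : forall t, 0 < t -> is_caputo_derive alpha u t (A (u t));
  sf_init : u 0 = x
}.

(* v' = A^m v + sum_{k=1}^{m-1} g_{k/m} A^k x on (0, oo), v(0) = x, for m >= 1.
   For m = 1 the sum is empty: [sum_n_m _ 1 0] is [zero]. *)
Record solves_inhomogeneous {X : CompleteNormedModule R_AbsRing}
    (m : nat) (A : operator X) (x : X) (v : R -> X) : Prop := {
  si_cont : continuous_nonneg v;
  si_dom : forall t, 0 < t -> op_dom (op_pow A m) (v t);
  si_equation : forall t, 0 < t ->
    is_derive v t
      (plus (op_pow A m (v t))
            (sum_n_m (fun k => scal (g (INR k / INR m) t) (op_pow A k x))
                     1 (m - 1)));
  si_init : v 0 = x
}.

(* Main.v *)
Require Import Defs.
From Stdlib Require Import Reals.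
From Coquelicot Require Import Coquelicot.
From Stdlib Require Import Lra Lia.

(** The substitution [w = (t - s)^b] turns the singular integral
    [int_0^t (t - s)^(b-1) f(s) ds] into the proper one
    [(1/b) int_0^(t^b) f(t - w^(1/b)) dw].  In this form the semigroup law
    [p_a * (p_b * f) = c p_(a+b) * f] for the kernels [p_b(t) = t^(b-1)] needs no
    Fubini theorem: it is explicit, with some constant [c = c(a, b)], when [f] is a
    step function, and step functions approximate continuous ones uniformly.
    Taking [f = exp], multiplying by [exp (- t)] and letting [t] tend to infinity
    gives [c = Gamma(a) Gamma(b) / Gamma(a + b)], hence [g_a * g_b = g_(a+b)].
    Convolving the resolvent equation with [g_(1-1/m)] gives the fractional
    problem, and iterating it on [x, A x, ..., A^(m-1) x] gives
    [S x = x + sum_(0<k<m) (g_(k/m) * 1) A^k x + 1 * S A^m x], whose derivative is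
    the second equation. *)

(** * The convolution with a power as a proper integral *)

(* Unlike [Rpower t b], this vanishes for [t <= 0], so it is continuous on [R] for [0 < b]. *)
Definition rpow (t b : R) : R := if Rle_dec t 0 then 0 else Rpower t b.

Lemma rpow_le0 t b : t <= 0 -> rpow t b = 0.
Proof. intros H; unfold rpow; destruct (Rle_dec t 0); [easy | lra]. Qed.

Lemma rpow_gt0 t b : 0 < t -> rpow t b = Rpower t b.
Proof. intros H; unfold rpow; destruct (Rle_dec t 0); [lra | easy]. Qed.

Lemma rpow_pos t b : 0 < t -> 0 < rpow t b.
Proof. intros H; rewrite rpow_gt0 by easy; apply exp_pos. Qed.

Lemma rpow_ge0 t b : 0 <= rpow t b.
Proof.
destruct (Rle_lt_dec t 0) as [H|H].
- rewrite rpow_le0 by easy; lra.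
- now apply Rlt_le, rpow_pos.
Qed.

Lemma rpow_1 t : 0 <= t -> rpow t 1 = t.
Proof.
intros [H| <-].
- rewrite rpow_gt0, Rpower_1; easy.
- apply rpow_le0; lra.
Qed.

Lemma rpow_base_1 b : rpow 1 b = 1.
Proof. rewrite rpow_gt0 by lra; unfold Rpower; rewrite ln_1, Rmult_0_r; apply exp_0. Qed.

Lemma rpow_inv t b : 0 < b -> 0 <= t -> rpow (rpow t b) (/ b) = t.
Proof.
intros Hb [H| <-].
- rewrite (rpow_gt0 t), rpow_gt0, Rpower_mult, Rinv_r, Rpower_1; try easy; try lra.
  apply exp_pos.
- rewrite (rpow_le0 0) by lra; apply rpow_le0; lra.
Qed.

Lemma rpow_inv_l t b : 0 < b -> 0 <= t -> rpow (rpow t (/ b)) b = t.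
Proof.
intros Hb Ht; rewrite <- (Rinv_inv b) at 2; apply rpow_inv; [|easy].
now apply Rinv_0_lt_compat.
Qed.

Lemma rpow_mult s t b : 0 <= s -> 0 <= t -> rpow (s * t) b = rpow s b * rpow t b.
Proof.
intros [Hs| <-]; [intros [Ht| <-]|intros Ht].
- rewrite !rpow_gt0; try easy; [|now apply Rmult_lt_0_compat].
  now rewrite Rpower_mult_distr.
- rewrite Rmult_0_r, (rpow_le0 0) by lra; lra.
- rewrite Rmult_0_l, (rpow_le0 0) by lra; lra.
Qed.

Lemma rpow_plus t a b : rpow t (a + b) = rpow t a * rpow t b.
Proof.
destruct (Rle_lt_dec t 0) as [H|H].
- rewrite !rpow_le0 by easy; lra.
- rewrite !rpow_gt0 by easy; apply Rpower_plus.
Qed.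

Lemma rpow_le s t b : 0 < b -> s <= t -> rpow s b <= rpow t b.
Proof.
intros Hb Hst; destruct (Rle_lt_dec s 0) as [H|H].
- rewrite rpow_le0 by easy; apply rpow_ge0.
- rewrite !rpow_gt0 by lra; apply Rle_Rpower_l; lra.
Qed.

Lemma rpow_lt s t b : 0 < b -> 0 < t -> s < t -> rpow s b < rpow t b.
Proof.
intros Hb Ht Hst; destruct (Rle_lt_dec s 0) as [H|H].
- rewrite rpow_le0 by easy; now apply rpow_pos.
- rewrite !rpow_gt0 by lra; apply Rlt_Rpower_l; lra.
Qed.

Lemma rpow_inv_le w t b : 0 < b -> 0 <= t -> w <= rpow t b -> rpow w (/ b) <= t.
Proof.
intros Hb Ht Hw; rewrite <- (rpow_inv t b) by easy.
apply rpow_le; [now apply Rinv_0_lt_compat | easy].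
Qed.

Lemma rpow_inv_lt w t b : 0 < b -> 0 <= t -> rpow t b < w -> t < rpow w (/ b).
Proof.
intros Hb Ht Hw; rewrite <- (rpow_inv t b) at 1 by easy.
pose proof (rpow_ge0 t b); apply rpow_lt; try lra; now apply Rinv_0_lt_compat.
Qed.

Lemma continuous_rpow b t : 0 < b -> continuous (fun s => rpow s b) t.
Proof.
intros Hb; destruct (Rtotal_order t 0) as [H|[->|H]].
- apply (continuous_ext_loc _ (fun _ : R => 0)); [|apply continuous_const].
  apply (filter_imp (fun s => s < 0)); [|now apply (open_lt 0)].
  intros s Hs; rewrite rpow_le0; lra.
- apply filterlim_locally; intros eps.
  (* For [|s| < eps^(1/b)], monotonicity of the power gives [s^b < eps]; negative [s] contribute the
     value 0. *)
  exists (mkposreal (rpow eps (/ b)) (rpow_pos _ _ (cond_pos eps))); simpl.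
  intros s Hs; change (Rabs (s - 0) < rpow eps (/ b)) in Hs.
  change (Rabs (rpow s b - rpow 0 b) < eps).
  rewrite (rpow_le0 0), Rminus_0_r, Rabs_pos_eq by (try apply rpow_ge0; lra).
  rewrite <- (rpow_inv_l eps b) by (try easy; apply Rlt_le, cond_pos).
  apply rpow_lt; [easy | apply rpow_pos, cond_pos |].
  apply Rle_lt_trans with (2 := Hs); rewrite Rminus_0_r; apply Rle_abs.
- apply (continuous_ext_loc _ (fun s : R => Rpower s b)).
  + apply (filter_imp (fun s => 0 < s)); [|now apply (open_gt 0)].
    intros s Hs; now rewrite rpow_gt0.
  + apply @ex_derive_continuous; exists (b * Rpower t (b - 1)).
    now apply is_derive_Reals, derivable_pt_lim_power.
Qed.

(* [v] is [b] times the convolution of [f] with [s^(b-1)] at [t], and [0] for [t <= 0]. *)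
Definition is_frac {V : NormedModule R_AbsRing} (b : R) (f : R -> V) (t : R) (v : V) : Prop :=
  is_RInt (fun w => f (t - rpow w (/ b))) 0 (rpow t b) v.

Section Frac.
Context {V : NormedModule R_AbsRing}.
Implicit Types (f h : R -> V) (v : V).

Lemma is_frac_ext b f h t v : 0 < b ->
  (forall s, 0 <= s <= t -> f s = h s) -> is_frac b f t v -> is_frac b h t v.
Proof.
intros Hb H; apply is_RInt_ext; intros w.
rewrite Rmin_left, Rmax_right by apply rpow_ge0; intros Hw.
destruct (Rle_lt_dec t 0) as [Ht|Ht].
- rewrite rpow_le0 in Hw by easy; lra.
- apply H; pose proof (rpow_ge0 w (/ b)).
  pose proof (rpow_inv_le w t b Hb (Rlt_le _ _ Ht)); lra.
Qed.

Lemma is_frac_plus b f h t u v :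
  is_frac b f t u -> is_frac b h t v -> is_frac b (fun s => plus (f s) (h s)) t (plus u v).
Proof. apply @is_RInt_plus. Qed.

Lemma is_frac_minus b f h t u v :
  is_frac b f t u -> is_frac b h t v -> is_frac b (fun s => minus (f s) (h s)) t (minus u v).
Proof. apply @is_RInt_minus. Qed.

Lemma is_frac_scal b f t k v :
  is_frac b f t v -> is_frac b (fun s => scal k (f s)) t (scal k v).
Proof. apply @is_RInt_scal. Qed.

Lemma is_frac_le0 b f t : t <= 0 -> is_frac b f t zero.
Proof. intros Ht; unfold is_frac; rewrite rpow_le0 by easy; apply @is_RInt_point. Qed.

Lemma is_frac_const b t v : is_frac b (fun _ => v) t (scal (rpow t b) v).
Proof.
unfold is_frac; rewrite <- (Rminus_0_r (rpow t b)) at 2; apply @is_RInt_const.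
Qed.

Lemma is_frac_norm_le b f t v M : 0 < b ->
  (forall s, 0 <= s <= t -> norm (f s) <= M) -> is_frac b f t v ->
  norm v <= rpow t b * M.
Proof.
intros Hb HM Hv; destruct (Rle_lt_dec t 0) as [Ht|Ht].
- unfold is_frac in Hv; rewrite rpow_le0 in Hv |- * by easy.
  (* For [t < 0] the hypothesis on [M] is vacuous and [M] may be negative. The interval is the
     single point 0, so the norm of the integrand there serves as the bound. *)
  rewrite Rmult_0_l, <- (Rmult_0_l (norm (f (t - rpow 0 (/ b))))), <- (Rminus_0_r 0) at 1.
  apply norm_RInt_le_const with (3 := Hv); [lra|].
  intros w Hw; replace w with 0 by lra; apply Rle_refl.
- rewrite <- (Rminus_0_r (rpow t b)).
  apply norm_RInt_le_const with (3 := Hv); [apply rpow_ge0|].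
  intros w Hw; apply HM; pose proof (rpow_ge0 w (/ b)).
  pose proof (rpow_inv_le w t b Hb (Rlt_le _ _ Ht)); lra.
Qed.

(** The two integrals share the integrand and differ only by the piece from [(t - c)^b] to [t^b].
    There [t - w^(1/b) - c] is negative, so the integrand vanishes. *)
Lemma is_frac_shift b f c t v : 0 < b -> 0 <= c ->
  (forall s, s < 0 -> f s = zero) ->
  is_frac b f (t - c) v -> is_frac b (fun s => f (s - c)) t v.
Proof.
intros Hb Hc Hf Hv; unfold is_frac in *.
assert (Hz : is_RInt (fun w => f (t - rpow w (/ b) - c)) (rpow (t - c) b) (rpow t b) zero).
{ apply is_RInt_ext with (fun _ => zero).
  - rewrite Rmin_left by (apply rpow_le; lra); intros w [Hw _].
    symmetry; apply Hf.
    destruct (Rle_lt_dec (t - c) 0) as [H|H].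
    + rewrite rpow_le0 in Hw by easy; pose proof (rpow_pos w (/ b) Hw); lra.
    + pose proof (rpow_inv_lt w (t - c) b Hb (Rlt_le _ _ H) Hw); lra.
  - pose proof (is_RInt_const (rpow (t - c) b) (rpow t b) (zero : V)) as E.
    refine (eq_ind _ (is_RInt _ _ _) E _ _); exact (scal_zero_r (K := R_AbsRing) _). }
rewrite <- (plus_zero_r v); apply is_RInt_Chasles with (2 := Hz).
apply is_RInt_ext with (2 := Hv); intros w _; f_equal; ring.
Qed.

(* Rescaling [w = t^b u] to a fixed interval of integration. *)
Lemma is_frac_unit b f t v : 0 < b -> 0 <= t ->
  is_frac b f t v ->
  is_RInt (fun u => scal (rpow t b) (f (t * (1 - rpow u (/ b))))) 0 1 v.
Proof.
intros Hb Ht Hv.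
apply is_RInt_ext with (fun u => scal (rpow t b) (f (t - rpow (rpow t b * u + 0) (/ b)))).
- rewrite Rmin_left by lra; intros u Hu.
  rewrite Rplus_0_r, rpow_mult, rpow_inv by (try apply rpow_ge0; lra).
  now do 2 f_equal; ring.
- apply (is_RInt_comp_lin (fun w => f (t - rpow w (/ b)))).
  now rewrite Rmult_0_r, !Rplus_0_r, Rmult_1_r.
Qed.
End Frac.

(** * The semigroup law *)

(** The Riemann-Liouville integral of order [b], up to the factor [b * Gamma b]: leaving this factor
    out postpones all facts about Gamma until after the semigroup law. *)
Definition frac {V : CompleteNormedModule R_AbsRing} (b : R) (f : R -> V) (t : R) : V :=
  RInt (fun w => f (t - rpow w (/ b))) 0 (rpow t b).

Lemma minus_eq_zero_reg {V : AbelianGroup} (x y : V) : minus x y = zero -> x = y.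
Proof.
intros H; apply (plus_reg_r (opp y)); rewrite plus_opp_r; exact H.
Qed.

Lemma plus_minus_cancel {V : AbelianGroup} (x y : V) : plus x (minus y x) = y.
Proof.
unfold minus; rewrite plus_comm, <- plus_assoc.
exact (eq_trans (f_equal (plus y) (plus_opp_l x)) (plus_zero_r y)).
Qed.

Lemma norm_minus_small_eq {V : NormedModule R_AbsRing} (x y : V) (C : R) :
  (forall eps : posreal, norm (minus x y) <= C * eps) -> x = y.
Proof.
intros H; apply minus_eq_zero_reg, norm_eq_zero.
apply Rle_antisym; [|apply norm_ge_0].
apply Rnot_lt_le; intros Hpos.
assert (HC : 0 < Rabs C + 1) by (pose proof (Rabs_pos C); lra).
(* With [N] the norm of the difference, this [eps] would give [N <= C * N / (|C| + 1) < N]. *)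
assert (He : 0 < norm (minus x y) / (Rabs C + 1)) by now apply Rdiv_lt_0_compat.
specialize (H (mkposreal _ He)); simpl in H.
pose proof (Rle_abs C) as HCa.
assert (norm (minus x y) / (Rabs C + 1) * (Rabs C + 1) = norm (minus x y)) by (field; lra).
nra.
Qed.

Section FracComplete.
Context {V : CompleteNormedModule R_AbsRing}.
Implicit Types (f h : R -> V) (v x : V).

Lemma frac_correct b f t : 0 < b ->
  (forall s, continuous f s) -> is_frac b f t (frac b f t).
Proof.
intros Hb Hf; apply @RInt_correct, ex_RInt_continuous; intros w _.
apply (continuous_comp (fun w => t - rpow w (/ b)) f); [|apply Hf].
apply (continuous_minus (fun _ : R => t) (fun w => rpow w (/ b))).
- apply continuous_const.
- now apply continuous_rpow, Rinv_0_lt_compat.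
Qed.

Lemma is_frac_unique b f t v : is_frac b f t v -> frac b f t = v.
Proof. apply is_RInt_unique. Qed.

Lemma frac_le0 b f t : t <= 0 -> frac b f t = zero.
Proof. intros Ht; now apply is_frac_unique, (is_frac_le0 (V := V)). Qed.

(** Moving [t] out of the bounds of integration serves twice: for continuity in [t], and for the
    homogeneity used in [is_frac_rpow]. *)
Lemma frac_unit b f t : 0 < b -> (forall s, continuous f s) ->
  frac b f t = scal (rpow t b) (RInt (fun u => f (t * (1 - rpow u (/ b)))) 0 1).
Proof.
intros Hb Hf; destruct (Rle_lt_dec t 0) as [Ht|Ht].
- rewrite frac_le0, rpow_le0 by easy; symmetry.
  exact (scal_zero_l (K := R_AbsRing) _).
- pose proof (is_frac_unit _ _ _ _ Hb (Rlt_le _ _ Ht) (frac_correct b f t Hb Hf)) as H.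
  rewrite <- (is_RInt_unique _ _ _ _ H); apply RInt_scal, ex_RInt_continuous.
  intros u _; apply (continuous_comp (fun u => t * (1 - rpow u (/ b))) f); [|apply Hf].
  apply (continuous_mult (fun _ : R => t) (fun u => 1 - rpow u (/ b))).
  + apply continuous_const.
  + apply (continuous_minus (fun _ : R => 1) (fun w => rpow w (/ b))).
    * apply continuous_const.
    * now apply continuous_rpow, Rinv_0_lt_compat.
Qed.

(** Since [|k| <= 1], the points [r * k u] with [|r - t| < 1] stay in the compact interval of radius
    [|t| + 1] and lie within [|r - t|] of [t * k u]. Uniform continuity of [f] on that interval then
    bounds the difference of the integrands for all [u] at once. *)
Lemma continuous_RInt_dilation f (k : R -> R) t :
  (forall s, continuous f s) -> (forall u, continuous k u) ->
  (forall u, 0 <= u <= 1 -> Rabs (k u) <= 1) ->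
  continuous (fun t => RInt (fun u => f (t * k u)) 0 1) t.
Proof.
intros Hf Hk Hk1.
assert (HI : forall t, is_RInt (fun u => f (t * k u)) 0 1 (RInt (fun u => f (t * k u)) 0 1)).
{ intros r; apply @RInt_correct, ex_RInt_continuous; intros u _.
  apply (continuous_comp (fun u => r * k u) f); [|apply Hf].
  apply (continuous_mult (fun _ : R => r) k); [apply continuous_const | apply Hk]. }
apply filterlim_locally; intros eps.
destruct (unifcont_normed_1d f (- (Rabs t + 1)) (Rabs t + 1) (fun s _ => Hf s) (pos_div_2 eps))
  as [d Hd].
assert (Hm : 0 < Rmin d 1) by (apply Rmin_glb_lt; [apply cond_pos | lra]).
exists (mkposreal _ Hm); simpl; intros r Hr; change (Rabs (r - t) < Rmin d 1) in Hr.
pose proof (Rmin_l d 1) as Hl; pose proof (Rmin_r d 1) as Hr1.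
apply (norm_compat1 (V := V)), Rle_lt_trans with ((1 - 0) * (eps / 2)).
2: { pose proof (cond_pos eps); lra. }
apply norm_RInt_le_const with (3 := is_RInt_minus _ _ _ _ _ _ (HI r) (HI t)); [lra|].
assert (Hin : forall s u, 0 <= u <= 1 -> Rabs s <= Rabs t + 1 ->
  - (Rabs t + 1) <= s * k u <= Rabs t + 1).
{ intros s u Hu Hs; apply Rabs_le_between; rewrite Rabs_mult.
  specialize (Hk1 u Hu); pose proof (Rabs_pos (k u)); pose proof (Rabs_pos s); nra. }
intros u Hu; apply Rlt_le, Hd.
- apply Hin; [easy | lra].
- apply Hin; [easy|]; pose proof (Rabs_triang (r - t) t) as Htri.
  replace (r - t + t) with r in Htri by ring; lra.
- change (Rabs (r * k u - t * k u) < d).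
  rewrite <- Rmult_minus_distr_r, Rabs_mult.
  specialize (Hk1 u Hu); pose proof (Rabs_pos (r - t)); nra.
Qed.

Lemma continuous_frac b f t : 0 < b -> (forall s, continuous f s) ->
  continuous (frac b f) t.
Proof.
intros Hb Hf.
apply continuous_ext with
  (fun t => scal (rpow t b) (RInt (fun u => f (t * (1 - rpow u (/ b)))) 0 1)).
{ intros r; symmetry; now apply frac_unit. }
pose proof (Rinv_0_lt_compat b Hb) as Hb'.
apply (continuous_scal (V := V) (fun t => rpow t b)
  (fun t => RInt (fun u => f (t * (1 - rpow u (/ b)))) 0 1)); [now apply continuous_rpow|].
apply continuous_RInt_dilation; [easy | |].
- intros u; apply (continuous_minus (fun _ : R => 1) (fun w => rpow w (/ b))).
  + apply continuous_const.
  + now apply continuous_rpow.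
- intros u Hu; pose proof (rpow_ge0 u (/ b)).
  pose proof (rpow_le u 1 (/ b) Hb' (proj2 Hu)) as H1; rewrite rpow_base_1 in H1.
  apply Rabs_le; lra.
Qed.

(** The fundamental theorem of calculus, applied to the primitive [y |-> (int_a^y k) v]. *)
Lemma is_RInt_scal_const_r (k : R -> R) a b v : (forall s, continuous k s) ->
  is_RInt (fun s => scal (k s) v) a b (scal (RInt k a b) v).
Proof.
intros Hk.
assert (Hex : forall c d, ex_RInt k c d) by (intros; apply @ex_RInt_continuous; auto).
replace (scal (RInt k a b) v) with (minus (scal (RInt k a b) v) (scal (RInt k a a) v)).
- apply (is_RInt_derive (fun y => scal (RInt k a y) v)).
  + intros y _; apply @is_derive_scal_l, (is_derive_RInt _ _ a); [|apply Hk].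
    apply filter_forall; intros z; apply @RInt_correct, Hex.
  + intros y _; apply (continuous_scal (V := V) k (fun _ => v)); [apply Hk | apply continuous_const].
- rewrite RInt_point.
  transitivity (minus (scal (RInt k a b) v) (zero : V)); [|exact (minus_zero_r _)].
  exact (f_equal (minus _) (scal_zero_l (K := R_AbsRing) v)).
Qed.

(** Step functions enter through an abstract property [P], stable under sums and true of every
    single jump; it is applied with [P] the semigroup law. The step length [d] comes from uniform
    continuity of [f] on [[0, T]]. *)
Lemma step_approximation (P : (R -> V) -> Prop) f (T : R) (eps : posreal) :
  (forall f h, P f -> P h -> P (fun s => plus (f s) (h s))) ->
  (forall c x, 0 <= c -> P (fun s => if Rle_dec 0 (s - c) then x else zero)) ->
  (forall s, continuous f s) -> 0 <= T ->
  exists phi, P phi /\ forall s, 0 <= s <= T -> norm (minus (f s) (phi s)) <= eps.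
Proof.
intros Pplus Pstep Hf HT.
destruct (unifcont_normed_1d f 0 T (fun s _ => Hf s) eps) as [d Hd].
pose proof (cond_pos d) as Hdpos.
(* After [n] jumps [phi] is constant, equal to [f (n d)], from [n d] on, and is still within [eps]
   of [f] up to [(n + 1) d]. The next jump, at [(n + 1) d], has height [f ((n + 1) d) - f (n d)]. *)
assert (Hn : forall n, exists phi, P phi /\
  (forall s, INR n * d <= s -> phi s = f (INR n * d)) /\
  (forall s, 0 <= s <= T -> s < INR (S n) * d -> norm (minus (f s) (phi s)) <= eps)).
{ assert (Hlast : forall n s, 0 <= s <= T -> INR n * d <= s < INR (S n) * d ->
    norm (minus (f s) (f (INR n * d))) <= eps).
  { intros n s Hs Hsn; rewrite S_INR in Hsn.
    pose proof (Rmult_le_pos _ _ (pos_INR n) (Rlt_le _ _ Hdpos)).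
    apply Rlt_le, Hd; [lra | easy |].
    change (Rabs (s - INR n * d) < d); apply Rabs_lt_between'; lra. }
  induction n as [|n [phi [HP [Heq Hle]]]].
  - exists (fun s => if Rle_dec 0 (s - 0) then f (INR 0 * d) else zero).
    split; [apply Pstep; lra|]; split.
    + intros s Hs; simpl INR in Hs; destruct (Rle_dec 0 (s - 0)); [easy | lra].
    + intros s Hs Hs1; destruct (Rle_dec 0 (s - 0)); [|lra].
      apply Hlast; [easy|]; split; [simpl INR; lra | easy].
  - exists (fun s => plus (phi s)
      (if Rle_dec 0 (s - INR (S n) * d) then minus (f (INR (S n) * d)) (f (INR n * d)) else zero)).
    assert (Heq' : forall s, INR (S n) * d <= s -> plus (phi s)
      (if Rle_dec 0 (s - INR (S n) * d) then minus (f (INR (S n) * d)) (f (INR n * d)) else zero)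
      = f (INR (S n) * d)).
    { intros s Hs; destruct (Rle_dec 0 (s - INR (S n) * d)); [|lra].
      rewrite Heq by (rewrite S_INR in Hs; lra).
      exact (plus_minus_cancel (f (INR n * d)) (f (INR (S n) * d))). }
    split; [|split].
    + apply Pplus; [easy|]; apply Pstep, Rmult_le_pos; [apply pos_INR | lra].
    + exact Heq'.
    + intros s Hs Hs1; destruct (Rlt_le_dec s (INR (S n) * d)) as [Hlt|Hge].
      * destruct (Rle_dec 0 (s - INR (S n) * d)); [lra|].
        rewrite plus_zero_r; now apply Hle.
      * rewrite Heq' by easy; now apply Hlast. }
(* With [n] the integer part of [T / d], the range [s < (n + 1) d] covers [[0, T]]. *)
destruct (nfloor_ex (T / d)) as [n [_ Hn1]]; [now apply Rdiv_le_0_compat|].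
destruct (Hn n) as [phi [HP [_ Hle]]]; exists phi; split; [easy|].
intros s Hs; apply Hle; [easy|]; rewrite S_INR.
apply Rle_lt_trans with (T / d * d); [|now apply Rmult_lt_compat_r].
replace (T / d * d) with T by (field; lra); lra.
Qed.

(* [a * b / (a + b)] times Euler's Beta function, to match the normalisation of [frac]. *)
Definition beta (a b : R) : R := RInt (fun u => rpow (1 - rpow u (/ a)) b) 0 1.

(** On the unit interval the argument is [t (1 - u^(1/a))], whose power splits into [t^b] and
    [(1 - u^(1/a))^b]. The latter integrates to [beta a b], and [t^b] joins the factor [t^a] of the
    rescaling. *)
Lemma is_frac_rpow a b t v : 0 < a -> 0 < b ->
  is_frac a (fun s => scal (rpow s b) v) t (scal (beta a b * rpow t (a + b)) v).
Proof.
intros Ha Hb.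
assert (Hc : forall s, continuous (fun s => scal (rpow s b) v) s).
{ intros s; apply (continuous_scal (V := V) (fun s => rpow s b) (fun _ => v)).
  - now apply continuous_rpow.
  - apply continuous_const. }
pose proof (frac_correct a _ t Ha Hc) as H; rewrite frac_unit in H by easy.
destruct (Rle_lt_dec t 0) as [Ht|Ht].
{ clear H; rewrite (rpow_le0 t (a + b)), Rmult_0_r by easy.
  replace (scal 0 v) with (zero : V) by (symmetry; exact (scal_zero_l (K := R_AbsRing) v)).
  now apply (is_frac_le0 (V := V)). }
refine (eq_ind _ (is_frac a _ t) H _ _); clear H.
transitivity (scal (rpow t a) (scal (rpow t b) (scal (beta a b) v))).
2: { rewrite !scal_assoc; f_equal; rewrite rpow_plus; unfold mult; simpl; ring. }
apply (f_equal (scal (rpow t a))), is_RInt_unique.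
apply is_RInt_ext with (fun u => scal (rpow t b) (scal (rpow (1 - rpow u (/ a)) b) v)).
- rewrite Rmin_left, Rmax_right by lra; intros u Hu.
  rewrite scal_assoc; f_equal; symmetry; apply rpow_mult; [lra|].
  pose proof (rpow_lt u 1 (/ a) (Rinv_0_lt_compat _ Ha)) as H1.
  rewrite rpow_base_1 in H1; lra.
- apply (is_RInt_scal (V := V)).
  apply (is_RInt_scal_const_r (fun u => rpow (1 - rpow u (/ a)) b)); intros s.
  apply (continuous_comp (fun u => 1 - rpow u (/ a)) (fun s => rpow s b));
    [|now apply continuous_rpow].
  apply (continuous_minus (fun _ : R => 1) (fun w => rpow w (/ a))).
  + apply continuous_const.
  + now apply continuous_rpow, Rinv_0_lt_compat.
Qed.

(** The semigroup law for one function [f], with [h] as the inner integral. It is relational because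
    it must apply to step functions, which are discontinuous and hence outside the scope of
    [frac_correct]. *)
Definition additive a b f : Prop := exists h, (forall s, is_frac b f s (h s)) /\
  forall t, exists v, is_frac (a + b) f t v /\ is_frac a h t (scal (beta a b) v).

(** By translation to [c = 0], a jump of height [x] integrates to [(s - c)^b x], and integrating
    this power again is [is_frac_rpow]. *)
Lemma additive_step a b c x : 0 < a -> 0 < b -> 0 <= c ->
  additive a b (fun s => if Rle_dec 0 (s - c) then x else zero).
Proof.
intros Ha Hb Hc.
assert (Hstep : forall b s, 0 < b ->
  is_frac b (fun s => if Rle_dec 0 (s - c) then x else zero) s (scal (rpow (s - c) b) x)).
{ intros d s Hd.
  apply (is_frac_shift d (fun s => if Rle_dec 0 s then x else zero)); try easy.
  - intros r Hr; destruct (Rle_dec 0 r); [lra | easy].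
  - apply is_frac_ext with (3 := is_frac_const d (s - c) x); [easy|].
    intros r Hr; destruct (Rle_dec 0 r); [easy | lra]. }
exists (fun s => scal (rpow (s - c) b) x); split; [now intros s; apply Hstep|].
intros t; exists (scal (rpow (t - c) (a + b)) x); split; [apply Hstep; lra|].
rewrite scal_assoc.
apply (is_frac_shift a (fun s => scal (rpow s b) x)); try easy.
- intros s Hs; rewrite rpow_le0 by lra; exact (scal_zero_l (K := R_AbsRing) x).
- now apply is_frac_rpow.
Qed.

Lemma additive_plus a b f h : additive a b f -> additive a b h ->
  additive a b (fun s => plus (f s) (h s)).
Proof.
intros [F [HF HF']] [H [HH HH']].
exists (fun s => plus (F s) (H s)); split.
{ intros s; exact (is_frac_plus (V := V) _ _ _ _ _ _ (HF s) (HH s)). }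
intros t; destruct (HF' t) as [u [Hu1 Hu2]]; destruct (HH' t) as [v [Hv1 Hv2]].
exists (plus u v); split; [exact (is_frac_plus (V := V) _ _ _ _ _ _ Hu1 Hv1)|].
refine (eq_ind _ (is_frac a _ t) (is_frac_plus (V := V) _ _ _ _ _ _ Hu2 Hv2) _ _).
exact (eq_sym (scal_distr_l (K := R_AbsRing) _ u v)).
Qed.

(* Both sides are continuous for uniform convergence, and the identity is
   explicit for step functions, by translation and homogeneity. *)
Lemma frac_frac a b f t : 0 < a -> 0 < b -> (forall s, continuous f s) ->
  frac a (frac b f) t = scal (beta a b) (frac (a + b) f t).
Proof.
intros Ha Hb Hf; destruct (Rle_lt_dec t 0) as [Ht|Ht].
{ rewrite !frac_le0 by easy; symmetry; exact (scal_zero_r (K := R_AbsRing) _). }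
(* Replacing [f] by a step function within [eps] costs [t^a t^b eps] in the iterated integral and
   [|beta a b| t^(a+b) eps] in the single one. *)
apply (norm_minus_small_eq _ _
  (rpow t a * rpow t b + Rabs (beta a b) * rpow t (a + b))); intros eps.
destruct (step_approximation (additive a b) f t eps) as [phi [[h [Hh Hphi]] Heps]];
  [now apply additive_plus | now intros c x Hc; apply additive_step | easy | lra |].
destruct (Hphi t) as [v [Hv1 Hv2]].
pose proof (frac_correct a (frac b f) t Ha (fun s => continuous_frac b f s Hb Hf)) as HL.
pose proof (frac_correct (a + b) f t ltac:(lra) Hf) as HR.
assert (H1 : norm (minus (frac a (frac b f) t) (scal (beta a b) v))
  <= rpow t a * (rpow t b * eps)).
{ apply is_frac_norm_le with (3 := is_frac_minus _ _ _ _ _ _ HL Hv2); [easy|].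
  intros s Hs; apply Rle_trans with (rpow s b * eps).
  - apply is_frac_norm_le with
      (3 := is_frac_minus _ _ _ _ _ _ (frac_correct b f s Hb Hf) (Hh s)); [easy|].
    intros r Hr; apply Heps; lra.
  - apply Rmult_le_compat_r; [apply Rlt_le, cond_pos | now apply rpow_le]. }
assert (H2 : norm (minus v (frac (a + b) f t)) <= rpow t (a + b) * eps).
{ rewrite <- norm_opp, opp_minus.
  apply is_frac_norm_le with (3 := is_frac_minus _ _ _ _ _ _ HR Hv1); [lra|].
  exact Heps. }
assert (E : minus (frac a (frac b f) t) (scal (beta a b) (frac (a + b) f t))
  = plus (minus (frac a (frac b f) t) (scal (beta a b) v))
         (scal (beta a b) (minus v (frac (a + b) f t)))).
{ rewrite (scal_minus_distr_l (K := R_AbsRing) (V := V)); apply minus_trans. }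
apply Rle_trans with (1 := Req_le _ _ (f_equal norm E)).
apply Rle_trans with (1 := norm_triangle (V := V) _ _).
rewrite Rmult_plus_distr_r; apply Rplus_le_compat; [rewrite Rmult_assoc; exact H1|].
apply Rle_trans with (1 := norm_scal (V := V) _ _); rewrite Rmult_assoc.
apply Rmult_le_compat_l with (2 := H2); apply Rabs_pos.
Qed.
End FracComplete.

(** * The Gamma function *)

Lemma is_RInt_gen_filterlim {V : NormedModule R_AbsRing} (f : R -> V)
    (Fa Fb : (R -> Prop) -> Prop) {FFa : Filter Fa} {FFb : Filter Fb}
    (I : R * R -> V) (l : V) :
  filter_prod Fa Fb (fun ab => is_RInt f (fst ab) (snd ab) (I ab)) ->
  filterlim I (filter_prod Fa Fb) (locally l) -> is_RInt_gen f Fa Fb l.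
Proof.
intros HI Hl P HP; change (filter_prod Fa Fb (fun ab => exists z, is_RInt f (fst ab) (snd ab) z /\ P z)).
apply (filter_imp (fun ab => is_RInt f (fst ab) (snd ab) (I ab) /\ P (I ab))).
- intros ab [H1 H2]; now exists (I ab).
- apply filter_and; [exact HI | exact (Hl P HP)].
Qed.

Lemma filterlim_incr_bounded (f : R -> R) (M : R) :
  (forall x y, x <= y -> f x <= f y) -> (forall x, f x <= M) ->
  exists L : R, filterlim f (Rbar_locally p_infty) (locally L) /\ forall x, f x <= L.
Proof.
intros Hincr HM.
destruct (completeness (fun y => exists x, y = f x)) as [L [HL1 HL2]].
- exists M; intros y [x ->]; apply HM.
- now exists (f 0), 0.
- assert (Hub : forall x, f x <= L) by (intros x; apply HL1; now exists x).
  exists L; split; [|exact Hub].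
  apply filterlim_locally; intros eps.
  destruct (Classical_Prop.classic (exists x, L - eps < f x)) as [[x Hx]|Hno].
  + exists x; intros y Hy; change (Rabs (f y - L) < eps).
    specialize (Hincr x y (Rlt_le _ _ Hy)); specialize (Hub y).
    pose proof (cond_pos eps); apply Rabs_def1; lra.
  + exfalso; pose proof (cond_pos eps).
    assert (L <= L - eps); [|lra].
    apply HL2; intros y [x ->]; apply Rnot_lt_le; intros Hx; apply Hno; now exists x.
Qed.

(* [b] times the lower incomplete Gamma function. *)
Definition incgamma (b t : R) : R := RInt (fun w => exp (- rpow w (/ b))) 0 (rpow t b).

Lemma continuous_exp_rpow b w : 0 < b -> continuous (fun w => exp (- rpow w (/ b))) w.
Proof.
intros Hb; apply (continuous_exp_comp (fun w => - rpow w (/ b))).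
apply (continuous_opp (fun w => rpow w (/ b))).
now apply continuous_rpow, Rinv_0_lt_compat.
Qed.

Lemma ex_RInt_exp_rpow b c d : 0 < b -> ex_RInt (fun w => exp (- rpow w (/ b))) c d.
Proof. intros Hb; apply @ex_RInt_continuous; intros; now apply continuous_exp_rpow. Qed.

Lemma incgamma_diff b s t : 0 < b ->
  incgamma b t - incgamma b s = RInt (fun w => exp (- rpow w (/ b))) (rpow s b) (rpow t b).
Proof.
intros Hb; unfold incgamma.
rewrite <- (RInt_Chasles (fun w => exp (- rpow w (/ b))) 0 (rpow s b) (rpow t b))
  by now apply ex_RInt_exp_rpow.
unfold plus; simpl; ring.
Qed.

Lemma incgamma_le b s t : 0 < b -> s <= t -> incgamma b s <= incgamma b t.
Proof.
intros Hb Hst; apply Rminus_le_0; rewrite incgamma_diff by easy.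
apply RInt_ge_0; [now apply rpow_le | now apply ex_RInt_exp_rpow |].
intros; apply Rlt_le, exp_pos.
Qed.

Lemma incgamma_0 b : incgamma b 0 = 0.
Proof. unfold incgamma; rewrite (rpow_le0 0) by lra; apply @RInt_point. Qed.

Lemma incgamma_ge0 b t : 0 < b -> 0 <= incgamma b t.
Proof.
intros Hb; apply RInt_ge_0; [apply rpow_ge0 | now apply ex_RInt_exp_rpow |].
intros; apply Rlt_le, exp_pos.
Qed.

(** The integrand is at least [exp (-1)] on the unit interval. This is the source of the positivity
    of [Gamma]. *)
Lemma incgamma_1_pos b : 0 < b -> 0 < incgamma b 1.
Proof.
intros Hb; unfold incgamma; rewrite rpow_base_1.
apply Rlt_le_trans with (RInt (fun _ => exp (-1)) 0 1).
- rewrite RInt_const; unfold scal; simpl; unfold mult; simpl.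
  pose proof (exp_pos (-1)); lra.
- apply RInt_le; [lra | apply @ex_RInt_const | now apply ex_RInt_exp_rpow |].
  intros w Hw; apply Rlt_le, exp_increasing.
  pose proof (rpow_lt w 1 (/ b) (Rinv_0_lt_compat b Hb)) as H1.
  rewrite rpow_base_1 in H1; lra.
Qed.

Lemma is_RInt_exp_opp c d : is_RInt (fun w => exp (- w)) c d (exp (- c) - exp (- d)).
Proof.
replace (exp (- c) - exp (- d)) with (minus (- exp (- d)) (- exp (- c)))
  by (unfold minus, plus, opp; simpl; ring).
apply (is_RInt_derive (fun w => - exp (- w))).
- intros w _; auto_derive; [easy | ring].
- intros w _; apply (continuous_exp_comp (fun w => - w)).
  apply (continuous_opp (fun w : R => w)), continuous_id.
Qed.

(* [exp (- w^(1/b)) <= exp (1 - w)] as [1 <= 1/b]. *)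
Lemma incgamma_bounded b t : 0 < b <= 1 -> incgamma b t <= exp 1.
Proof.
intros [Hb Hb1].
pose proof (is_RInt_scal _ _ _ (exp 1) _ (is_RInt_exp_opp 0 (rpow t b))) as HI.
apply Rle_trans with (exp 1 * (exp (- 0) - exp (- rpow t b))).
- refine (is_RInt_le _ _ _ _ _ _ (rpow_ge0 t b)
    (RInt_correct _ _ _ (ex_RInt_exp_rpow b 0 (rpow t b) Hb)) HI _).
  intros w [Hw _]; change (exp (- rpow w (/ b)) <= exp 1 * exp (- w)).
  rewrite <- exp_plus.
  assert (Hle : - rpow w (/ b) <= 1 + - w).
  { destruct (Rle_lt_dec w 1) as [H|H]; [pose proof (rpow_ge0 w (/ b)); lra|].
    rewrite rpow_gt0 by easy; rewrite <- (Rpower_1 w) at 2 by easy.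
    assert (1 <= / b) as [H1| <-].
    { rewrite <- Rinv_1; now apply Rinv_le_contravar. }
    - pose proof (Rpower_lt w 1 (/ b) H H1); lra.
    - lra. }
  destruct Hle as [Hlt|Heq]; [now apply Rlt_le, exp_increasing | rewrite Heq; lra].
- rewrite Ropp_0, exp_0; pose proof (exp_pos (- rpow t b)); pose proof (exp_pos 1); nra.
Qed.

Lemma continuous_incgamma b t : 0 < b -> continuous (incgamma b) t.
Proof.
intros Hb; apply (continuous_comp (fun t => rpow t b)
  (fun y => RInt (fun w => exp (- rpow w (/ b))) 0 y)); [now apply continuous_rpow|].
apply (continuous_RInt_1 (fun w => exp (- rpow w (/ b))) 0).
apply filter_forall; intros z; apply @RInt_correct; now apply ex_RInt_exp_rpow.
Qed.

(** Substitute [w = s^b], so that [dw = b s^(b-1) ds] and [w^(1/b) = s]. *)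
Lemma is_RInt_gamma b c d : 0 < b -> 0 < c -> 0 < d ->
  is_RInt (fun t => Rpower t (b - 1) * exp (- t)) c d (/ b * (incgamma b d - incgamma b c)).
Proof.
intros Hb Hc Hd; rewrite incgamma_diff, !rpow_gt0 by easy.
assert (Hpos : forall s, Rmin c d <= s <= Rmax c d -> 0 < s).
{ intros s [Hs _]; apply Rlt_le_trans with (2 := Hs); now apply Rmin_glb_lt. }
apply is_RInt_ext with
  (fun s => scal (/ b) (scal (b * Rpower s (b - 1)) (exp (- rpow (Rpower s b) (/ b))))).
- intros s Hs.
  assert (Hs0 : 0 < s) by (apply Hpos; lra).
  rewrite <- (rpow_gt0 s b), rpow_inv by lra.
  assert (E : / b * (b * Rpower s (b - 1) * exp (- s)) = Rpower s (b - 1) * exp (- s))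
    by (field; lra).
  exact E.
- apply (is_RInt_scal (V := R_NormedModule)).
  apply (is_RInt_comp (fun w => exp (- rpow w (/ b))) (fun s => Rpower s b)).
  + intros; now apply continuous_exp_rpow.
  + intros s Hs; specialize (Hpos s Hs); split.
    * now apply is_derive_Reals, derivable_pt_lim_power.
    * apply (continuous_mult (fun _ : R => b) (fun s => Rpower s (b - 1)));
        [apply continuous_const|].
      apply @ex_derive_continuous; exists ((b - 1) * Rpower s (b - 1 - 1)).
      now apply is_derive_Reals, derivable_pt_lim_power.
Qed.

(** A limit at infinity exists by monotonicity and boundedness, the latter being where [b <= 1]
    enters. The improper integral [Gamma b] is then [/ b] times this limit, because [incgamma b]
    tends to 0 at its lower end by continuity. *)
Lemma filterlim_incgamma b : 0 < b <= 1 ->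
  filterlim (incgamma b) (Rbar_locally p_infty) (locally (b * Gamma b)).
Proof.
intros [Hb Hb1].
destruct (filterlim_incr_bounded (incgamma b) (exp 1)) as [L [HL _]].
{ intros; now apply incgamma_le. }
{ intros; now apply incgamma_bounded. }
replace (b * Gamma b) with L; [exact HL|].
enough (HG : Gamma b = / b * (L - 0)) by (rewrite HG; field; lra).
unfold Gamma; refine (is_RInt_gen_unique (V := R_CompleteNormedModule) _ _ _).
apply (@is_RInt_gen_filterlim R_NormedModule _ _ _ _ _
  (fun ab => / b * (incgamma b (snd ab) - incgamma b (fst ab)))).
- apply Filter_prod with (fun c => 0 < c) (fun d => 0 < d).
  + exists (mkposreal 1 Rlt_0_1); intros; easy.
  + now exists 0.
  + intros c d Hc Hd; now apply is_RInt_gamma.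
- apply (filterlim_comp _ _ _ (fun ab => incgamma b (snd ab) - incgamma b (fst ab))
    (fun y => / b * y) _ (locally (L - 0))).
  2: apply (filterlim_scal_r (/ b) (L - 0) : filterlim (fun y : R => scal (/ b) y) _ _).
  apply (filterlim_comp_2 (G := locally L) (H := locally (- 0))
    (fun ab : R * R => incgamma b (snd ab)) (fun ab => - incgamma b (fst ab)) Rplus).
  + exact (filterlim_comp _ _ _ snd (incgamma b) _ _ _ filterlim_snd HL).
  + apply (filterlim_comp _ _ _ (fun ab : R * R => incgamma b (fst ab)) Ropp _ (locally 0));
      [|exact (filterlim_opp (V := R_NormedModule) 0)].
    apply (filterlim_comp _ _ _ fst (incgamma b) _ _ _ filterlim_fst).
    rewrite <- (incgamma_0 b) at 2.
    apply filterlim_filter_le_1 with (2 := continuous_incgamma b 0 Hb).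
    intros P [d Hd]; exists d; intros y Hy _; now apply Hd.
  + apply (filterlim_plus (V := R_NormedModule)).
Qed.

Lemma Gamma_pos b : 0 < b <= 1 -> 0 < Gamma b.
Proof.
intros Hb; apply Rmult_lt_reg_l with b; [easy|]; rewrite Rmult_0_r.
apply Rlt_le_trans with (incgamma b 1); [now apply incgamma_1_pos|].
apply (filterlim_le (F := Rbar_locally p_infty) (fun _ => incgamma b 1) (incgamma b)
  (incgamma b 1) (b * Gamma b)).
- exists 1; intros x Hx; apply incgamma_le; lra.
- apply filterlim_const.
- now apply filterlim_incgamma.
Qed.

(** For [t > 0], [incgamma 1 t] is [1 - exp (- t)], which tends to 1. *)
Lemma Gamma_1 : Gamma 1 = 1.
Proof.
rewrite <- (Rmult_1_l (Gamma 1)).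
apply (filterlim_locally_unique (F := Rbar_locally p_infty) (incgamma 1)).
{ apply filterlim_incgamma; lra. }
apply (filterlim_ext_loc (fun t => 1 + - exp (- t))).
- exists 0; intros t Ht; unfold incgamma; rewrite rpow_1 by lra; symmetry.
  apply is_RInt_unique.
  apply is_RInt_ext with (fun w => exp (- w)).
  + rewrite Rmin_left by lra; intros w Hw; rewrite Rinv_1, rpow_1; [easy | lra].
  + pose proof (is_RInt_exp_opp 0 t) as HE; rewrite Ropp_0, exp_0 in HE; exact HE.
- assert (H1 : filterlim (fun t => 1 + - exp (- t)) (Rbar_locally p_infty) (locally (1 + 0)));
    [|rewrite Rplus_0_r in H1; exact H1].
  apply (filterlim_comp_2 (G := locally 1) (H := locally 0)
    (fun _ : R => 1) (fun t => - exp (- t)) Rplus).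
  + apply filterlim_const.
  + rewrite <- Ropp_0.
    apply (filterlim_comp _ _ _ (fun t => exp (- t)) Ropp _ (locally 0));
      [|exact (filterlim_opp (V := R_NormedModule) 0)].
    apply (filterlim_comp _ _ _ Ropp exp _ (Rbar_locally m_infty)); [|exact is_lim_exp_m].
    exact (filterlim_Rbar_opp p_infty).
  + apply (filterlim_plus (V := R_NormedModule)).
Qed.

(** * The Beta constant in terms of Gamma *)

Lemma frac_exp b t : 0 < b -> frac b exp t = exp t * incgamma b t.
Proof.
intros Hb; apply is_RInt_unique.
apply is_RInt_ext with (fun w => scal (exp t) (exp (- rpow w (/ b)))).
- intros w _; symmetry; apply exp_plus.
- apply (is_RInt_scal (V := R_NormedModule)), @RInt_correct; now apply ex_RInt_exp_rpow.
Qed.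

(** The semigroup law for [exp] at [2 t], divided by [exp (2 t)], writes the middle term as the
    integral of [exp (- w^(1/a)) * incgamma b (2 t - w^(1/a))] over [0 <= w <= (2 t)^a]. For the
    lower bound keep only [w <= t^a], where [2 t - w^(1/a) >= t]; for the upper bound use
    [2 t - w^(1/a) <= 2 t]. Geometrically, a triangle of side [2 t] lies between the squares of
    sides [t] and [2 t]. *)
Lemma incgamma_prod_le a b t : 0 < a -> 0 < b -> 0 <= t ->
  incgamma a t * incgamma b t <= beta a b * incgamma (a + b) (2 * t)
    <= incgamma a (2 * t) * incgamma b (2 * t).
Proof.
intros Ha Hb Ht.
assert (Hexp : forall s, continuous exp s) by apply continuous_exp.
set (h := fun s => exp s * incgamma b s).
assert (Hh : forall s, continuous h s).
{ intros s; apply (continuous_mult exp (incgamma b)); [apply Hexp|].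
  now apply continuous_incgamma. }
assert (E : RInt (fun w => h (2 * t - rpow w (/ a))) 0 (rpow (2 * t) a)
  = exp (2 * t) * (beta a b * incgamma (a + b) (2 * t))).
{ transitivity (frac a (frac b exp) (2 * t)).
  - apply RInt_ext; intros w _; symmetry; now apply frac_exp.
  - rewrite frac_frac by easy; rewrite frac_exp by lra.
    unfold scal; simpl; unfold mult; simpl; ring. }
assert (Hex : forall c d, ex_RInt (fun w => h (2 * t - rpow w (/ a))) c d).
{ intros c d; apply @ex_RInt_continuous; intros w _.
  apply (continuous_comp (fun w => 2 * t - rpow w (/ a)) h); [|apply Hh].
  apply (continuous_minus (fun _ : R => 2 * t) (fun w => rpow w (/ a))).
  - apply continuous_const.
  - now apply continuous_rpow, Rinv_0_lt_compat. }
assert (HI : forall s r, is_RInt (fun w => exp (2 * t - rpow w (/ a)) * incgamma b r)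
   0 (rpow s a) (exp (2 * t) * (incgamma a s * incgamma b r))).
{ intros s r.
  replace (exp (2 * t) * (incgamma a s * incgamma b r))
    with (scal (exp (2 * t) * incgamma b r) (incgamma a s))
    by (unfold scal; simpl; unfold mult; simpl; ring).
  apply is_RInt_ext with (fun w => scal (exp (2 * t) * incgamma b r) (exp (- rpow w (/ a)))).
  - intros w _; unfold Rminus; rewrite exp_plus; unfold scal; simpl; unfold mult; simpl; ring.
  - apply (is_RInt_scal (V := R_NormedModule)), @RInt_correct; now apply ex_RInt_exp_rpow. }
split; apply Rmult_le_reg_l with (exp (2 * t)); try apply exp_pos; rewrite <- E.
- rewrite <- (is_RInt_unique _ _ _ _ (HI t t)).
  rewrite <- (RInt_Chasles (fun w => h (2 * t - rpow w (/ a))) 0 (rpow t a) (rpow (2 * t) a))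
    by apply Hex.
  rewrite <- (Rplus_0_r (RInt _ _ _)) at 1; apply Rplus_le_compat.
  + apply RInt_le; [apply rpow_ge0 | eexists; apply HI | apply Hex |].
    intros w Hw; apply Rmult_le_compat_l; [apply Rlt_le, exp_pos|].
    apply incgamma_le; [easy|].
    pose proof (rpow_inv_le w t a Ha Ht); lra.
  + apply RInt_ge_0; [apply rpow_le; lra | apply Hex |].
    intros w Hw; apply Rmult_le_pos; [apply Rlt_le, exp_pos | now apply incgamma_ge0].
- rewrite <- (is_RInt_unique _ _ _ _ (HI (2 * t) (2 * t))).
  apply RInt_le; [apply rpow_ge0 | apply Hex | eexists; apply HI |].
  intros w Hw; apply Rmult_le_compat_l; [apply Rlt_le, exp_pos|].
  apply incgamma_le; [easy|]; pose proof (rpow_ge0 w (/ a)); lra.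
Qed.

(** Let [t] tend to infinity in [incgamma_prod_le]: both outer products have the same limit. The
    bound [a + b <= 1] puts all three orders within reach of [filterlim_incgamma]. *)
Lemma beta_Gamma a b : 0 < a -> 0 < b -> a + b <= 1 ->
  beta a b * ((a + b) * Gamma (a + b)) = (a * Gamma a) * (b * Gamma b).
Proof.
intros Ha Hb Hab.
assert (H2 : filterlim (fun t => 2 * t) (Rbar_locally p_infty) (Rbar_locally p_infty)).
{ intros P [M HM]; exists (M / 2); intros x Hx; apply HM; lra. }
assert (Hprod : filterlim (fun t => incgamma a t * incgamma b t)
  (Rbar_locally p_infty) (locally ((a * Gamma a) * (b * Gamma b)))).
{ apply (filterlim_comp_2 (G := locally (a * Gamma a)) (H := locally (b * Gamma b))
    (incgamma a) (incgamma b) Rmult).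
  - apply filterlim_incgamma; lra.
  - apply filterlim_incgamma; lra.
  - apply (filterlim_mult (K := R_AbsRing)). }
assert (Hbeta : filterlim (fun t => beta a b * incgamma (a + b) (2 * t))
  (Rbar_locally p_infty) (locally (beta a b * ((a + b) * Gamma (a + b))))).
{ apply (filterlim_comp _ _ _ (fun t => incgamma (a + b) (2 * t))
    (fun y => beta a b * y) _ (locally ((a + b) * Gamma (a + b)))).
  - apply filterlim_comp with (1 := H2); apply filterlim_incgamma; lra.
  - apply (filterlim_scal_r (beta a b) ((a + b) * Gamma (a + b))
      : filterlim (fun y : R => scal (beta a b) y) _ _). }
apply Rle_antisym.
- apply (filterlim_le (F := Rbar_locally p_infty) _ _
    (beta a b * ((a + b) * Gamma (a + b))) ((a * Gamma a) * (b * Gamma b)))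
    with (2 := Hbeta) (3 := filterlim_comp _ _ _ _ _ _ _ _ H2 Hprod).
  exists 0; intros t Ht; apply incgamma_prod_le; lra.
- apply (filterlim_le (F := Rbar_locally p_infty) _ _
    ((a * Gamma a) * (b * Gamma b)) (beta a b * ((a + b) * Gamma (a + b))))
    with (2 := Hprod) (3 := Hbeta).
  exists 0; intros t Ht; apply incgamma_prod_le; lra.
Qed.

(** * Convolution with [g_b] on [[0, oo)] *)

Lemma locally_nonneg_nbhs t (P : R -> Prop) : locally t P -> nonneg_nbhs t P.
Proof. intros [d Hd]; exists d; auto. Qed.

Lemma nonneg_nbhs_ge0 t (P : R -> Prop) : (forall s, 0 <= s -> P s) -> nonneg_nbhs t P.
Proof. intros H; exists (mkposreal 1 Rlt_0_1); auto. Qed.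

#[local] Instance nonneg_nbhs_filter t : Filter (nonneg_nbhs t).
Proof. apply within_filter, locally_filter. Qed.

Lemma filterdiff_nonneg_nbhs {V : NormedModule R_AbsRing} (f F : R -> V) (t : R) (l : V) :
  0 <= t -> (forall s, 0 <= s -> f s = F s) -> is_derive F t l ->
  filterdiff f (nonneg_nbhs t) (fun h : R => scal h l).
Proof.
intros Ht Hf [Hl Hd]; split; [exact Hl|]; intros z Hz.
replace z with t.
- intros eps; destruct (Hd t (fun P HP => HP) eps) as [d Hd']; exists d.
  intros s Hs Hs0; rewrite !Hf by easy; exact (Hd' s Hs).
(* The filter has no limit point other than [t]: as [t >= 0], the point [t] lies in every set of the
   filter, in particular in the ball of radius [|t - z| / 2] around a limit point [z]. *)
- destruct (Req_dec z t) as [E|E]; [easy | exfalso].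
  assert (Hpos : 0 < Rabs (t - z) / 2).
  { pose proof (Rabs_pos_lt (t - z)); lra. }
  pose proof (Hz _ (locally_ball z (mkposreal _ Hpos))) as H.
  pose proof (locally_singleton _ _ H Ht) as H1.
  change (Rabs (t - z) < Rabs (t - z) / 2) in H1; lra.
Qed.

Section Convolution.
Context {X : CompleteNormedModule R_AbsRing}.
Implicit Types (f h : R -> X) (x : X).

(** Freezing [f] at its value at 0 on the negative half-line makes it continuous on all of [R], as
    the results on [frac] require. *)
Lemma continuous_nonneg_extend f : continuous_nonneg f ->
  forall s, continuous (fun s => f (Rmax 0 s)) s.
Proof.
intros Hf s.
apply (filterlim_comp _ _ _ (Rmax 0) f _ (nonneg_nbhs (Rmax 0 s))); [|apply Hf, Rmax_l].
intros P [d Hd]; exists d; intros r Hr; apply Hd; [|apply Rmax_l].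
change (Rabs (r - s) < d) in Hr; change (Rabs (Rmax 0 r - Rmax 0 s) < d).
apply Rle_lt_trans with (2 := Hr); unfold Rmax.
destruct (Rle_dec 0 r), (Rle_dec 0 s); unfold Rabs;
  repeat destruct (Rcase_abs _); lra.
Qed.

Lemma continuous_continuous_nonneg f : (forall s, continuous f s) -> continuous_nonneg f.
Proof. intros Hf t _ P HP; apply locally_nonneg_nbhs; exact (Hf t P HP). Qed.

(** On [[0, d]] with [d < t] the kernel is regular and the substitution [w = (t - s)^b] is
    legitimate; then [d] tends to [t] from the left. *)
Lemma conv_g_frac b f t : 0 < b -> continuous_nonneg f ->
  conv_g b f t = scal (/ (b * Gamma b)) (frac b (fun s => f (Rmax 0 s)) t).
Proof.
intros Hb Hf; pose proof (continuous_nonneg_extend f Hf) as HF.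
unfold conv_g; destruct (Req_EM_T b 0); [lra|].
destruct (Rle_dec t 0) as [Ht|Ht].
{ rewrite frac_le0 by easy; symmetry; exact (scal_zero_r (K := R_AbsRing) _). }
apply Rnot_le_lt in Ht; apply is_RInt_gen_unique.
set (Phi := fun w => f (Rmax 0 (t - rpow w (/ b)))).
assert (HPhi : forall w, continuous Phi w).
{ intros w; apply (continuous_comp (fun w => t - rpow w (/ b)) (fun s => f (Rmax 0 s)));
    [|apply HF].
  apply (continuous_minus (fun _ : R => t) (fun w => rpow w (/ b))).
  - apply continuous_const.
  - now apply continuous_rpow, Rinv_0_lt_compat. }
apply (@is_RInt_gen_filterlim X _ _ _ _ _ (fun ab =>
  scal (/ (b * Gamma b)) (RInt Phi (rpow (t - snd ab) b) (rpow t b)))).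
- apply Filter_prod with (fun c => c = 0) (fun d => 0 < d < t).
  + reflexivity.
  + exists (mkposreal t Ht); intros d Hd Hdt; change (Rabs (d - t) < t) in Hd.
    apply Rabs_def2 in Hd; lra.
  + intros c d -> Hd; simpl fst; simpl snd.
    assert (Hpos : forall s, Rmin d 0 <= s <= Rmax d 0 -> 0 < t - s).
    { rewrite Rmax_left by lra; intros; lra. }
    rewrite !rpow_gt0 by lra.
    (* The substitution is decreasing, so the integral is first taken from [d] down to 0; swapping
       the bounds cancels the sign of the derivative. *)
    assert (HI : is_RInt (fun s => scal (- (b * Rpower (t - s) (b - 1))) (Phi (Rpower (t - s) b)))
      d 0 (RInt Phi (Rpower (t - d) b) (Rpower t b))).
    { replace (Rpower t b) with (Rpower (t - 0) b) by now rewrite Rminus_0_r.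
      apply (is_RInt_comp Phi (fun s => Rpower (t - s) b)); [intros; apply HPhi|].
      intros s Hs; specialize (Hpos s Hs).
      assert (HD : forall c, is_derive (fun s => Rpower (t - s) c) s
        (- (c * Rpower (t - s) (c - 1)))).
      { intros c.
        replace (- (c * Rpower (t - s) (c - 1)))
          with (scal (-1) (c * Rpower (t - s) (c - 1)))
          by (unfold scal; simpl; unfold mult; simpl; ring).
        apply (is_derive_comp (fun r => Rpower r c) (fun s => t - s)).
        - now apply is_derive_Reals, derivable_pt_lim_power.
        - auto_derive; [easy | ring]. }
      split; [apply HD|].
      apply (continuous_opp (fun s => b * Rpower (t - s) (b - 1))).
      apply (continuous_mult (fun _ : R => b) (fun s => Rpower (t - s) (b - 1)));
        [apply continuous_const|].
      apply @ex_derive_continuous; eexists; apply HD. }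
    apply is_RInt_swap in HI.
    pose proof (is_RInt_scal (V := X) _ _ _ (- / (b * Gamma b)) _ HI) as HJ.
    assert (E : forall v : X, scal (- / (b * Gamma b)) (opp v) = scal (/ (b * Gamma b)) v).
    { intros v.
      exact (eq_trans (scal_opp_l (K := R_AbsRing) (/ (b * Gamma b)) (opp v))
        (eq_trans (f_equal opp (scal_opp_r (K := R_AbsRing) (/ (b * Gamma b)) v))
          (opp_opp (scal (/ (b * Gamma b)) v)))). }
    refine (eq_ind _ (is_RInt _ _ _) _ _ (E _)).
    apply is_RInt_ext with (2 := HJ).
    rewrite Rmin_left, Rmax_right by lra; intros s Hs.
    rewrite scal_assoc; unfold Phi.
    rewrite <- (rpow_gt0 (t - s) b), rpow_inv by lra.
    replace (t - (t - s)) with s by ring; rewrite Rmax_right by lra.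
    f_equal; unfold g, mult; simpl.
    (* [Gamma_pos] covers [b <= 1] only. If [Gamma b] were 0, both sides would vanish, since
       [/ 0 = 0]. *)
    destruct (Req_dec (Gamma b) 0) as [HG0|HG0].
    * rewrite HG0, Rmult_0_r; unfold Rdiv; rewrite Rinv_0; ring.
    * field; lra.
- apply (filterlim_comp _ _ _ snd
    (fun d => scal (/ (b * Gamma b)) (RInt Phi (rpow (t - d) b) (rpow t b)))
    _ _ _ filterlim_snd).
  apply (filterlim_comp _ _ _ (fun d => RInt Phi (rpow (t - d) b) (rpow t b))
    (fun v => scal (/ (b * Gamma b)) v) _ (locally (frac b (fun s => f (Rmax 0 s)) t)));
    [|exact (filterlim_scal_r (V := X) _ _)].
  (* Since [rpow (t - d) b] is 0 for [d >= t], the expression is continuous at [d = t] from both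
     sides, and the left limit is its value there. *)
  apply (filterlim_filter_le_1 (F := locally t) (fun d => RInt Phi (rpow (t - d) b) (rpow t b))).
  { intros P [d Hd]; exists d; intros s Hs _; now apply Hd. }
  change (frac b (fun s => f (Rmax 0 s)) t) with (RInt Phi 0 (rpow t b)).
  replace 0 with (rpow (t - t) b) by (apply rpow_le0; lra).
  apply (continuous_comp (fun d => rpow (t - d) b) (fun y => RInt Phi y (rpow t b))).
  + apply (continuous_comp (fun d => t - d) (fun s => rpow s b)); [|now apply continuous_rpow].
    apply (continuous_minus (fun _ : R => t) (fun d => d));
      [apply continuous_const | apply continuous_id].
  + apply (continuous_RInt_2 Phi (rpow (t - t) b) (rpow t b) (fun y => RInt Phi y (rpow t b))).
    apply filter_forall; intros z; apply @RInt_correct, @ex_RInt_continuous; intros; apply HPhi.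
Qed.

Lemma conv_g_ext b f h t : 0 < b -> continuous_nonneg f -> continuous_nonneg h ->
  (forall s, 0 <= s -> f s = h s) -> conv_g b f t = conv_g b h t.
Proof.
intros Hb Hf Hh H; rewrite !conv_g_frac by easy.
apply (f_equal (scal _)), RInt_ext; intros w _; apply H, Rmax_l.
Qed.

Lemma continuous_conv_g b f : 0 < b -> continuous_nonneg f ->
  continuous_nonneg (conv_g b f).
Proof.
intros Hb Hf; apply continuous_continuous_nonneg; intros s.
apply continuous_ext with
  (fun t => scal (/ (b * Gamma b)) (frac b (fun s => f (Rmax 0 s)) t)).
{ intros r; symmetry; now apply conv_g_frac. }
apply (continuous_scal_r (V := X) (/ (b * Gamma b)) (frac b (fun s => f (Rmax 0 s)))).
apply continuous_frac; [easy | now apply continuous_nonneg_extend].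
Qed.

Lemma conv_g_plus b f h t : 0 < b -> continuous_nonneg f -> continuous_nonneg h ->
  continuous_nonneg (fun s => plus (f s) (h s)) ->
  conv_g b (fun s => plus (f s) (h s)) t = plus (conv_g b f t) (conv_g b h t).
Proof.
intros Hb Hf Hh Hfh; rewrite !conv_g_frac by easy.
refine (eq_trans (f_equal (scal _) _) (scal_distr_l (K := R_AbsRing) _ _ _)).
apply is_frac_unique, (is_frac_plus (V := X));
  (apply frac_correct; [easy | now apply continuous_nonneg_extend]).
Qed.

Lemma continuous_nonneg_const x : continuous_nonneg (fun _ => x).
Proof. apply continuous_continuous_nonneg; intros s; apply continuous_const. Qed.

Lemma conv_g_const b x t : 0 < b ->
  conv_g b (fun _ => x) t = scal (rpow t b / (b * Gamma b)) x.
Proof.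
intros Hb; rewrite conv_g_frac by (try easy; apply continuous_nonneg_const).
rewrite (is_frac_unique _ _ _ _ (is_frac_const b t x)).
rewrite scal_assoc; f_equal; apply Rmult_comm.
Qed.

(** This is [frac_frac] with the normalising factors restored; [beta_Gamma] says exactly that they
    absorb the constant [beta a b]. *)
Lemma conv_g_conv_g a b f t : 0 < a -> 0 < b -> a + b <= 1 -> continuous_nonneg f ->
  conv_g a (conv_g b f) t = conv_g (a + b) f t.
Proof.
intros Ha Hb Hab Hf; pose proof (continuous_nonneg_extend f Hf) as HF.
rewrite conv_g_frac by (try easy; now apply continuous_conv_g).
set (F := fun s => f (Rmax 0 s)) in *.
assert (E : frac a (fun s => conv_g b f (Rmax 0 s)) t
  = scal (/ (b * Gamma b)) (scal (beta a b) (frac (a + b) F t))).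
{ rewrite <- frac_frac by easy; apply is_frac_unique.
  apply (is_frac_ext (V := X)) with (fun s => scal (/ (b * Gamma b)) (frac b F s)); [easy| |].
  - intros s Hs; rewrite Rmax_right by lra; symmetry; now apply conv_g_frac.
  - apply (is_frac_scal (V := X)), frac_correct; [easy|].
    intros s; now apply continuous_frac. }
rewrite E, (conv_g_frac (a + b)) by (try easy; lra); fold F.
rewrite !scal_assoc; apply (f_equal (fun k => scal k _)).
change (/ (a * Gamma a) * / (b * Gamma b) * beta a b = / ((a + b) * Gamma (a + b))).
pose proof (Gamma_pos a ltac:(lra)); pose proof (Gamma_pos b ltac:(lra)).
pose proof (Gamma_pos (a + b) ltac:(lra)).
apply Rmult_eq_reg_r with ((a + b) * Gamma (a + b)).
2: { apply Rgt_not_eq, Rmult_lt_0_compat; lra. }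
rewrite Rmult_assoc, beta_Gamma by easy; field; lra.
Qed.

(** For order 1 the power substitution is the reflection [w = t - s], and the normalising factor is
    1 by [Gamma_1]. *)
Lemma conv_g_1 f t : 0 <= t -> continuous_nonneg f ->
  conv_g 1 f t = RInt (fun s => f (Rmax 0 s)) 0 t.
Proof.
intros Ht Hf; rewrite conv_g_frac by (try easy; lra).
pose proof (continuous_nonneg_extend f Hf) as HF.
rewrite Gamma_1, Rmult_1_r, Rinv_1; refine (eq_trans (scal_one (K := R_AbsRing) _) _).
apply is_frac_unique; unfold is_frac; rewrite rpow_1 by easy.
set (F := fun s => f (Rmax 0 s)) in *.
assert (HI : is_RInt F t 0 (opp (RInt F 0 t))).
{ apply (is_RInt_swap (V := X)), @RInt_correct, @ex_RInt_continuous; auto. }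
rewrite <- (Rplus_0_l t) in HI at 1.
replace (0 + t) with (-1 * 0 + t) in HI by ring.
replace 0 with (-1 * t + t) in HI at 2 by ring.
pose proof (is_RInt_opp (V := X) _ _ _ _ (is_RInt_comp_lin (V := X) F (-1) t 0 t _ HI)) as HJ.
refine (eq_ind _ (is_RInt _ _ _) _ _ (opp_opp (RInt F 0 t))).
apply is_RInt_ext with (2 := HJ).
rewrite Rmin_left, Rmax_right by easy; intros w Hw.
rewrite Rinv_1, rpow_1 by lra.
replace (-1 * w + t) with (t - w) by ring.
refine (eq_trans (f_equal opp (scal_opp_one (K := R_AbsRing) (F (t - w)))) (opp_opp _)).
Qed.

Lemma is_derive_RInt_extend f t : continuous_nonneg f -> 0 <= t ->
  is_derive (fun t => RInt (fun s => f (Rmax 0 s)) 0 t) t (f t).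
Proof.
intros Hf Ht; pose proof (continuous_nonneg_extend f Hf) as HF.
rewrite <- (Rmax_right 0 t) at 2 by easy.
apply (is_derive_RInt (fun s => f (Rmax 0 s)) _ 0); [|apply HF].
apply filter_forall; intros z; apply @RInt_correct, @ex_RInt_continuous; auto.
Qed.
End Convolution.

(** * Resolvent families *)

Lemma C1_nonneg_RInt {X : CompleteNormedModule R_AbsRing} (f h : R -> X) :
  continuous_nonneg h ->
  (forall t, 0 <= t -> f t = RInt (fun s => h (Rmax 0 s)) 0 t) -> C1_nonneg f.
Proof.
intros Hh Hf; exists h; split; [|exact Hh].
intros t Ht; apply filterdiff_nonneg_nbhs with (fun t => RInt (fun s => h (Rmax 0 s)) 0 t);
  [easy | exact Hf | now apply is_derive_RInt_extend].
Qed.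

Lemma locally_pos_ge0 t : 0 < t -> locally t (fun s => 0 <= s).
Proof.
intros Ht; apply (filter_imp (fun s => 0 < s)); [intros; lra | now apply (open_gt 0)].
Qed.

Lemma filterlim_norm_minus {V : NormedModule R_AbsRing} (f : R -> V) t :
  continuous_nonneg f -> 0 <= t ->
  filterlim (fun s => norm (minus (f s) (f t))) (nonneg_nbhs t) (locally 0).
Proof.
intros Hf Ht; apply filterlim_locally; intros eps.
pose proof (proj1 (filterlim_locally_ball_norm f (f t)) (Hf t Ht) eps) as H.
revert H; apply filter_imp; intros s Hs.
change (Rabs (norm (minus (f s) (f t)) - 0) < eps).
rewrite Rminus_0_r, Rabs_pos_eq by apply norm_ge_0; exact Hs.
Qed.

Section Operators.
Context {X : CompleteNormedModule R_AbsRing} {A : operator X}.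

Lemma op_pow_dom_lt m k x : op_dom (op_pow A m) x -> (k < m)%nat ->
  op_dom A (op_pow A k x).
Proof.
revert k; induction m as [|m IH]; intros k Hx Hk; [lia|].
destruct Hx as [Hx1 Hx2].
assert (k = m \/ k < m)%nat as [-> | Hlt] by lia; [exact Hx2 | now apply IH].
Qed.

Lemma linear_operator_minus x y : linear_operator A -> op_dom A x -> op_dom A y ->
  A (minus x y) = minus (A x) (A y).
Proof.
intros HA Hx Hy.
assert (E : forall z : X, opp z = scal (-1) z).
{ intros z; symmetry; exact (scal_opp_one (K := R_AbsRing) z). }
unfold minus; rewrite !E.
rewrite (lin_plus _ HA); [|easy | now apply (lin_dom_scal _ HA)].
now rewrite (lin_scal _ HA).
Qed.
End Operators.

Section ResolventFamily.
Context {X : CompleteNormedModule R_AbsRing} {A : operator X} {S : R -> X -> X} {alpha : R}.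
Context (hS : resolvent_family alpha A S) (halpha : 0 < alpha).

Lemma op_pow_resolvent k x t : 0 <= t -> op_dom (op_pow A k) x ->
  op_dom (op_pow A k) (S t x) /\ op_pow A k (S t x) = S t (op_pow A k x).
Proof.
intros Ht; induction k as [|k IH]; [easy|].
intros [Hx1 Hx2]; destruct (IH Hx1) as [H1 H2].
destruct (rf_commute _ _ _ hS t _ Ht Hx2) as [H3 H4].
simpl; rewrite H2; now repeat split.
Qed.

(** Since [A] commutes with [S] on its domain, the graph norm of an increment of [S x] is the sum of
    the norms of the increments of [S x] and [S (A x)], both strongly continuous. *)
Lemma continuous_nonneg_dom_resolvent x : linear_operator A -> op_dom A x ->
  continuous_nonneg_dom A (fun t => S t x).
Proof.
intros hlin Hx; split.
{ intros t Ht; exact (proj1 (rf_commute _ _ _ hS t x Ht Hx)). }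
intros t Ht; unfold graph_norm.
apply filterlim_ext_loc with
  (fun s => norm (minus (S s x) (S t x)) + norm (minus (S s (A x)) (S t (A x)))).
{ apply nonneg_nbhs_ge0; intros s Hs.
  destruct (rf_commute _ _ _ hS t x Ht Hx) as [H1 H2].
  destruct (rf_commute _ _ _ hS s x Hs Hx) as [H3 H4].
  pose proof (linear_operator_minus _ _ hlin H3 H1) as E; rewrite H2, H4 in E.
  exact (f_equal (fun z => norm (minus (S s x) (S t x)) + norm z) (eq_sym E)). }
apply (filterlim_comp_2 (G := locally 0) (H := locally 0)
  (fun s => norm (minus (S s x) (S t x))) (fun s => norm (minus (S s (A x)) (S t (A x)))) Rplus).
- exact (filterlim_norm_minus (fun s => S s x) t (rf_strong_cont _ _ _ hS x) Ht).
- exact (filterlim_norm_minus (fun s => S s (A x)) t (rf_strong_cont _ _ _ hS (A x)) Ht).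
- pose proof (filterlim_plus (V := R_NormedModule) 0 0) as H.
  change (plus (0 : R) 0) with (0 + 0) in H; rewrite Rplus_0_r in H; exact H.
Qed.

(* [g_(1-alpha) * (S x - x) = g_(1-alpha) * g_alpha * S A x = g_1 * S A x]. *)
Lemma conv_g_resolvent_minus x t : alpha <= 1 -> op_dom A x -> 0 <= t ->
  conv_g (1 - alpha) (fun s => minus (S s x) x) t
  = RInt (fun s => S (Rmax 0 s) (A x)) 0 t.
Proof.
intros Ha Hx Ht.
pose proof (rf_strong_cont _ _ _ hS (A x)) as HC.
assert (E : forall s, 0 <= s -> minus (S s x) x = conv_g alpha (fun s => S s (A x)) s).
{ intros s Hs; rewrite (rf_equation _ _ _ hS s x Hs Hx).
  unfold minus; rewrite (plus_comm x), <- plus_assoc.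
  exact (eq_trans (f_equal (plus _) (plus_opp_r x)) (plus_zero_r _)). }
rewrite <- (conv_g_1 (fun s => S s (A x))) by easy.
(* For [alpha = 1] the outer kernel is the Dirac delta, to which the semigroup law for positive
   orders does not apply; the convolution is then the identity. *)
destruct (Req_dec alpha 1) as [H1|H1].
- unfold conv_g at 1; destruct (Req_EM_T (1 - alpha) 0); [|lra].
  rewrite E by easy; now rewrite H1.
- rewrite (conv_g_ext (1 - alpha) _ (conv_g alpha (fun s => S s (A x)))).
  + rewrite conv_g_conv_g by (try easy; lra); f_equal; ring.
  + lra.
  + intros s Hs; unfold minus; apply (filterlim_comp _ _ _ (fun s => S s x)
      (fun y => plus y (opp x)) _ (locally (S s x))).
    * exact (rf_strong_cont _ _ _ hS x s Hs).
    * apply (continuous_plus (V := X) (fun y => y) (fun _ => opp x));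
        [apply continuous_id | apply continuous_const].
  + now apply continuous_conv_g.
  + exact E.
Qed.

(** By [conv_g_resolvent_minus] the function to be differentiated is the primitive of [S (A x)],
    which equals [A (S x)]. This gives both the regularity and the equation. *)
Lemma solves_fractional_resolvent x : alpha <= 1 -> linear_operator A -> op_dom A x ->
  solves_fractional alpha A x (fun t => S t x).
Proof.
intros Ha hlin Hx; split.
- now apply continuous_nonneg_dom_resolvent.
- apply C1_nonneg_RInt with (fun s => S s (A x)); [apply (rf_strong_cont _ _ _ hS)|].
  intros t Ht; now apply conv_g_resolvent_minus.
- intros t Ht; unfold is_caputo_derive; rewrite (rf_zero _ _ _ hS).
  rewrite (proj2 (rf_commute _ _ _ hS t x (Rlt_le _ _ Ht) Hx)).
  apply is_derive_ext_loc with (fun t => RInt (fun s => S (Rmax 0 s) (A x)) 0 t).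
  + apply filter_imp with (2 := locally_pos_ge0 t Ht); intros s Hs.
    symmetry; now apply conv_g_resolvent_minus.
  + apply (is_derive_RInt_extend (fun s => S s (A x))); [|lra].
    apply (rf_strong_cont _ _ _ hS).
- apply (rf_zero _ _ _ hS).
Qed.
End ResolventFamily.

(** * Expansion of the resolvent family and the first-order problem *)

(* [g_(b+1)], written without [Gamma (b + 1)]. *)
Definition monomial_kernel (b t : R) : R := rpow t b / (b * Gamma b).

Lemma is_derive_monomial_kernel b t : 0 < b -> 0 < t ->
  is_derive (monomial_kernel b) t (g b t).
Proof.
intros Hb Ht.
apply is_derive_ext_loc with (fun s => Rpower s b * / (b * Gamma b)).
{ apply (filter_imp (fun s => 0 < s)); [|now apply (open_gt 0)].
  intros s Hs; unfold monomial_kernel; now rewrite rpow_gt0. }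
replace (g b t) with (b * Rpower t (b - 1) * / (b * Gamma b)).
- apply (is_derive_scal_l (V := R_NormedModule) (fun s => Rpower s b)).
  now apply is_derive_Reals, derivable_pt_lim_power.
- unfold g, Rdiv; rewrite Rinv_mult.
  (* Both sides are linear in [/ Gamma b], so it can be treated as an arbitrary constant. *)
  generalize (/ Gamma b); intros c; field; lra.
Qed.

Lemma is_derive_sum_n_m {V : NormedModule R_AbsRing} (f df : nat -> R -> V) n m t :
  (forall k, (n <= k <= m)%nat -> is_derive (f k) t (df k t)) ->
  is_derive (fun t => sum_n_m (fun k => f k t) n m) t (sum_n_m (fun k => df k t) n m).
Proof.
intros H; induction m as [|m IH].
- destruct n as [|n].
  + apply is_derive_ext with (f 0%nat).
    { intros s; symmetry; apply (sum_n_n (fun k => f k s)). }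
    rewrite sum_n_n; apply H; lia.
  + apply is_derive_ext with (fun _ => zero).
    { intros s; symmetry; apply (sum_n_m_zero (fun k => f k s)); lia. }
    rewrite sum_n_m_zero by lia; apply @is_derive_const.
- destruct (Compare_dec.le_lt_dec n (Datatypes.S m)) as [Hle|Hlt].
  + apply is_derive_ext with
      (fun s => plus (sum_n_m (fun k => f k s) n m) (f (Datatypes.S m) s)).
    { intros s; symmetry; now apply (sum_n_Sm (fun k => f k s)). }
    rewrite sum_n_Sm by easy; apply @is_derive_plus; [|apply H; lia].
    apply IH; intros k Hk; apply H; lia.
  + apply is_derive_ext with (fun _ => zero).
    { intros s; symmetry; apply (sum_n_m_zero (fun k => f k s)); lia. }
    rewrite sum_n_m_zero by lia; apply @is_derive_const.
Qed.

(* Iterating [S y = y + g_(1/m) * S A y] at [y = x, A x, ..., A^i x]. *)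
Lemma resolvent_expansion {X : CompleteNormedModule R_AbsRing} (m : nat)
    (A : operator X) (S : R -> X -> X) (x : X) (i : nat) (t : R) :
  resolvent_family (1 / INR m) A S -> op_dom (op_pow A m) x ->
  (i < m)%nat -> 0 <= t ->
  S t x = plus (plus x (sum_n_m (fun k =>
                  scal (monomial_kernel (INR k / INR m) t) (op_pow A k x)) 1 i))
               (conv_g (INR (Datatypes.S i) / INR m)
                  (fun s => S s (op_pow A (Datatypes.S i) x)) t).
Proof.
intros hS Hx Hi Ht.
assert (Hm : 0 < INR m) by (apply lt_0_INR; lia).
assert (HC : forall y, continuous_nonneg (fun s => S s y)) by apply (rf_strong_cont _ _ _ hS).
induction i as [|i IH].
- rewrite sum_n_m_zero, plus_zero_r by lia.
  exact (rf_equation _ _ _ hS t x Ht (op_pow_dom_lt m 0 x Hx Hi)).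
- rewrite IH by lia; clear IH.
  rewrite sum_n_Sm by lia; rewrite plus_assoc, <- (plus_assoc (plus x _)).
  apply (f_equal (plus _)).
  (* The remainder is the convolution of [S y] with the kernel of order [(i + 1) / m]. The resolvent
     equation at [y] splits it: the constant [y] yields the new term of the sum, and the convolution
     yields the next remainder by the semigroup law. *)
  set (y := op_pow A (Datatypes.S i) x).
  assert (Hy : op_dom A y) by now apply op_pow_dom_lt with m.
  assert (Hb : 0 < INR (Datatypes.S i) / INR m).
  { apply Rdiv_lt_0_compat; [apply lt_0_INR; lia | easy]. }
  assert (H1m : 0 < 1 / INR m) by (apply Rdiv_lt_0_compat; lra).
  assert (Hsum : INR (Datatypes.S i) / INR m + 1 / INR m
    = INR (Datatypes.S (Datatypes.S i)) / INR m).
  { rewrite (S_INR (Datatypes.S i)); field; lra. }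
  assert (Hext : forall s, 0 <= s ->
    S s y = plus y (conv_g (1 / INR m) (fun s => S s (A y)) s)).
  { intros s Hs; exact (rf_equation _ _ _ hS s y Hs Hy). }
  assert (HCc : continuous_nonneg (conv_g (1 / INR m) (fun s => S s (A y))))
    by now apply continuous_conv_g.
  assert (HCp : continuous_nonneg
    (fun s => plus y (conv_g (1 / INR m) (fun s => S s (A y)) s))).
  { intros s Hs; apply (filterlim_comp _ _ _ _ (plus y) _ _ _ (HCc s Hs)).
    apply (continuous_plus (V := X) (fun _ => y) (fun z => z));
      [apply continuous_const | apply continuous_id]. }
  rewrite (conv_g_ext _ _ _ t Hb (HC y) HCp Hext).
  rewrite conv_g_plus by (try easy; apply continuous_nonneg_const).
  rewrite conv_g_const by easy; apply (f_equal (plus _)).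
  rewrite conv_g_conv_g; try easy.
  + rewrite Hsum; reflexivity.
  (* The new order [(i + 2) / m] is at most 1 because [i + 1 < m]. *)
  + rewrite Hsum; apply Rle_div_l; [easy|]; rewrite Rmult_1_l; apply le_INR; lia.
Qed.

Theorem proposition4p6 (X : CompleteNormedModule R_AbsRing) (m : nat)
    (A : operator X) (S : R -> X -> X)
    (hm : (1 <= m)%nat)
    (hlin : linear_operator A)
    (hdense : densely_defined A)
    (hclosed : closed_operator A)
    (hS : resolvent_family (1 / INR m) A S)
    (x : X) (hx : op_dom (op_pow A m) x) :
  solves_fractional (1 / INR m) A x (fun t => S t x) /\
  solves_inhomogeneous m A x (fun t => S t x).
Proof.
assert (Hm : 1 <= INR m) by now apply (le_INR 1).
assert (Halpha : 0 < 1 / INR m) by (apply Rdiv_lt_0_compat; lra).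
split.
{ apply solves_fractional_resolvent; try easy.
  - apply Rle_div_l; lra.
  - exact (op_pow_dom_lt m 0 x hx hm). }
split.
- apply (rf_strong_cont _ _ _ hS).
- intros t Ht; apply (op_pow_resolvent hS); [lra | easy].
- intros t Ht.
  rewrite (proj2 (op_pow_resolvent hS m x t (Rlt_le _ _ Ht) hx)).
  rewrite plus_comm.
  (* At [i = m - 1] the remainder has order [m / m = 1], so it is the primitive of [S (A^m x)]. The
     expansion holds on the nonnegative half-line, a neighbourhood of [t > 0], and can be
     differentiated term by term. *)
  apply is_derive_ext_loc with (fun t => plus
    (plus x (sum_n_m (fun k =>
       scal (monomial_kernel (INR k / INR m) t) (op_pow A k x)) 1 (m - 1)))
    (RInt (fun s => S (Rmax 0 s) (op_pow A m x)) 0 t)).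
  { apply filter_imp with (2 := locally_pos_ge0 t Ht); intros s Hs.
    rewrite (resolvent_expansion m A S x (m - 1) s hS hx) by (lia || easy).
    replace (Datatypes.S (m - 1)) with m by lia.
    rewrite Rdiv_diag by lra; apply (f_equal (plus _)); symmetry.
    apply (conv_g_1 (fun s => S s (op_pow A m x))); [easy|].
    apply (rf_strong_cont _ _ _ hS). }
  apply @is_derive_plus.
  + match goal with |- is_derive _ _ ?l => rewrite <- (plus_zero_l l) end.
    apply @is_derive_plus; [apply @is_derive_const|].
    apply (is_derive_sum_n_m (V := X)
      (fun k t => scal (monomial_kernel (INR k / INR m) t) (op_pow A k x))
      (fun k t => scal (g (INR k / INR m) t) (op_pow A k x))).
    intros k Hk; apply @is_derive_scal_l, is_derive_monomial_kernel; [|easy].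
    apply Rdiv_lt_0_compat; [apply lt_0_INR; lia | lra].
  + apply (is_derive_RInt_extend (fun s => S s (op_pow A m x))); [|lra].
    apply (rf_strong_cont _ _ _ hS).
- apply (rf_zero _ _ _ hS).
Qed.
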